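(* Let $K=\mathbb{F}_q$ be a finite field with $q\neq 2$. Let $\mathcal{C}$ be a clutter with vertices $y_1,\ldots,y_n$ and $s\geq 2$ edges with characteristic vectors $v_1,\ldots,v_s$. Let $X\subset\mathbb{P}^{s-1}$ be the projective algebraic toric set parameterized by $y^{v_1},\ldots,y^{v_s}$ and let $X'\subset\mathbb{P}^{s-2}$ be the projective algebraic toric set parameterized by $y^{v_1},\ldots,y^{v_{s-1}}$. Put $S=K[t_1,\ldots,t_s]$ and $S'=K[t_1,\ldots,t_{s-1}]$. If $y_n$ is a free vertex of $\mathcal{C}$ and $y_n\in{\rm supp}(y^{v_s})$, then (a) $I(X)=I(X')+(t_1^{q-1}-t_s^{q-1})$, where $I(X')$ on the right denotes its extension $I(X')S$; (b) ${\rm reg}\, S/I(X)={\rm reg}\, S'/I(X')+(q-2)$; (c) ${\rm deg}\, S/I(X)=(q-1)\,{\rm deg}\, S'/I(X')$.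
   Context: A clutter $\mathcal{C}$ is a family of subsets (edges) of a finite vertex set $\{y_1,\ldots,y_n\}$ such that no edge is contained in a different edge. The characteristic vector of an edge $f$ is $\sum_{y_j\in f}e_j\in\{0,1\}^n$. A vertex is free if it appears in only one of the edges of $\mathcal{C}$. The support of a monomial $y^a=y_1^{a_1}\cdots y_n^{a_n}$ is ${\rm supp}(y^a)=\{y_i : a_i\neq 0\}$. For monomials $y^{w_1},\ldots,y^{w_m}$ in $y_1,\ldots,y_n$, the projective algebraic toric set parameterized by them is $Z=\{[(x^{w_1},\ldots,x^{w_m})] : x\in (K^* )^n\}\subset\mathbb{P}^{m-1}$ (projective space over $K$), where $K^*=K\setminus\{0\}$ and $x^{w}=x_1^{w_1}\cdots x_n^{w_n}$. Its vanishing ideal $I(Z)$ is the ideal of $R=K[t_1,\ldots,t_m]$ (standard grading) generated by the homogeneous polynomials vanishing on $Z$. The Hilbert function $H_Z(d)=\dim_K(R/I(Z))_d$ is constant for $d\gg 0$, the constant being the degree ${\rm deg}\,R/I(Z)=|Z|$; ${\rm reg}\,R/I(Z)$ is the least integer $p\geq 0$ such that $H_Z(d)=|Z|$ for all $d\geq p$ (this equals the Castelnuovo-Mumford regularity). *)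

(* Defs.v *)
From mathcomp Require Import all_boot all_order all_algebra.
From mathcomp Require Import mpoly.
From Stdlib Require Import ClassicalEpsilon.

Set Implicit Arguments.
Unset Strict Implicit.
Unset Printing Implicit Defensive.

Import GRing.Theory.
Local Open Scope ring_scope.

Definition clutter (V : finType) (C : {set {set V}}) : Prop :=
  forall e f : {set V}, e \in C -> f \in C -> e \subset f -> e = f.

Definition free_vertex (V : finType) (C : {set {set V}}) (y : V) : Prop :=
  #|[set e in C | y \in e]| = 1%N.

Definition charvec (n : nat) (e : {set 'I_n}) : 'X_{1..n} :=
  [multinom (y \in e : nat) | y < n].

(* The support of the monomial 'X_[a] (not to be confused with [msupp]). *)
Definition supp_mon (n : nat) (a : 'X_{1..n}) : {set 'I_n} :=
  [set y | a y != 0%N].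

Section Ideals.
Variables (m : nat) (K : finFieldType).
Implicit Types (G I J : {mpoly K[m]} -> Prop).

Definition ideal_gen G : {mpoly K[m]} -> Prop := fun f =>
  exists (k : nat) (a g : 'I_k -> {mpoly K[m]}),
    (forall i, G (g i)) /\ f = \sum_(i < k) a i * g i.

Definition ideal_add I J : {mpoly K[m]} -> Prop := fun f =>
  exists a b, [/\ I a, J b & f = a + b].

(* The classes of b_0, ..., b_(k-1) form a K-basis of (R/I)_d = R_d / (I :&: R_d),
   where R = K[t_1, ..., t_m] is standard graded. *)
Definition quot_basis I (d k : nat) (b : 'I_k -> {mpoly K[m]}) : Prop :=
  [/\ forall i, b i \is d.-homog,
      forall c : 'I_k -> K, I (\sum_(i < k) c i *: b i) -> forall i, c i = 0
    & forall f, f \is d.-homog ->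
        exists c : 'I_k -> K, I (f - \sum_(i < k) c i *: b i)].

Definition hilbert_function I (d : nat) : nat :=
  epsilon (inhabits 0%N) (fun k => exists b : 'I_k -> _, quot_basis I d b).

End Ideals.

Definition ideal_ext (m : nat) (K : finFieldType) (I : {mpoly K[m]} -> Prop) :
    {mpoly K[m.+1]} -> Prop :=
  ideal_gen (fun g => exists2 f, I f & g = mwiden f).

Section Projective.
Variables (m : nat) (K : finFieldType).

(* A point of P^(m-1) is the set of all its vectors of homogeneous
   coordinates. *)
Definition proj_point (u : 'rV[K]_m) : {set 'rV[K]_m} :=
  [set c *: u | c in [set c : K | c != 0]].

Definition toric_set (n : nat) (w : 'I_m -> 'X_{1..n}) : {set {set 'rV[K]_m}} :=
  [set proj_point (\row_(j < m) ('X_[w j] : {mpoly K[n]}).@[x])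
     | x : {ffun 'I_n -> K} in [set x : {ffun 'I_n -> K} | [forall i, x i != 0]]].

Definition vanishing_ideal (Z : {set {set 'rV[K]_m}}) : {mpoly K[m]} -> Prop :=
  ideal_gen (fun f => (exists d, f \is d.-homog) /\
    forall P u, P \in Z -> u \in P -> f.@[fun i => u 0 i] = 0).

(* deg R/I(Z): the eventually constant value of the Hilbert function. *)
Definition deg (Z : {set {set 'rV[K]_m}}) : nat :=
  epsilon (inhabits 0%N) (fun D =>
    exists d0, forall d, (d0 <= d)%N ->
      hilbert_function (vanishing_ideal Z) d = D).

(* [p] is an index from which the Hilbert function of R/I(Z) equals |Z|. *)
Definition stable_from (Z : {set {set 'rV[K]_m}}) (p : nat) : Prop :=
  forall d, (p <= d)%N -> hilbert_function (vanishing_ideal Z) d = #|Z|.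

(* reg R/I(Z) *)
Definition reg (Z : {set {set 'rV[K]_m}}) : nat :=
  epsilon (inhabits 0%N) (fun p =>
    stable_from Z p /\ forall p', stable_from Z p' -> (p <= p')%N).

End Projective.

(* Main.v *)
(* Since y_n occurs in v_s only, with exponent 1, the last coordinate of a point
   of X is free: the cone over X is the product of the cone over X' and K^*.
   Division by t_1^(q-1) - t_s^(q-1), which vanishes on X, writes a homogeneous f
   of degree d as sum_(i < q-1) f_i t_s^i with f_i in S' homogeneous of degree
   d - i; for fixed t_1, ..., t_(s-1) this is a polynomial in t_s of degree less
   than q - 1, so that it vanishes on K^* only if every f_i vanishes. This gives
   (a), and H_X(d) = sum_(i < q-1) H_X'(d - i). As H_X' is bounded by |X'| and
   eventually equal to it, |X| = (q-1)|X'|, and H_X(d) = |X| exactly when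
   H_X'(d - i) = |X'| for all i <= q - 2, whence (b) and (c). *)
Require Import Defs.
From mathcomp Require Import all_boot all_order all_algebra.
From mathcomp Require Import mpoly finfield.
From Stdlib Require Import Classical ClassicalEpsilon.

Set Implicit Arguments.
Unset Strict Implicit.
Unset Printing Implicit Defensive.

Import GRing.Theory.
Local Open Scope ring_scope.

(** * Ideals given by generators *)

Lemma ideal_gen_sub (m : nat) (K : finFieldType) (G : {mpoly K[m]} -> Prop) g :
  G g -> ideal_gen G g.
Proof.
move=> Gg; exists 1%N, (fun=> 1), (fun=> g); split=> //.
by rewrite big_ord1 mul1r.
Qed.

Lemma ideal_genD (m : nat) (K : finFieldType) (G : {mpoly K[m]} -> Prop) f g :
  ideal_gen G f -> ideal_gen G g -> ideal_gen G (f + g).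
Proof.
move=> [k [a [u [Gu ->]]]] [l [b [w [Gw ->]]]].
exists (k + l)%N,
  (fun i => match split i with inl j => a j | inr j => b j end),
  (fun i => match split i with inl j => u j | inr j => w j end).
split; first by move=> i; case: (split i).
rewrite big_split_ord /=; congr (_ + _); apply: eq_bigr => i _.
  by rewrite -[lshift _ _]/(unsplit (inl i)) unsplitK.
by rewrite -[rshift _ _]/(unsplit (inr i)) unsplitK.
Qed.

Lemma ideal_genM (m : nat) (K : finFieldType) (G : {mpoly K[m]} -> Prop) a f :
  ideal_gen G f -> ideal_gen G (a * f).
Proof.
move=> [k [b [u [Gu ->]]]]; exists k, (fun i => a * b i), u; split=> //.
by rewrite mulr_sumr; apply: eq_bigr => i _; rewrite mulrA.
Qed.

Lemma ideal_gen0 (m : nat) (K : finFieldType) (G : {mpoly K[m]} -> Prop) :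
  ideal_gen G 0.
Proof.
by exists 0%N, (fun=> 0), (fun=> 0); split; [case | rewrite big_ord0].
Qed.

Lemma ideal_genZ (m : nat) (K : finFieldType) (G : {mpoly K[m]} -> Prop) c f :
  ideal_gen G f -> ideal_gen G (c *: f).
Proof. by rewrite -mul_mpolyC; apply: ideal_genM. Qed.

Lemma ideal_gen_sum (m : nat) (K : finFieldType) (G : {mpoly K[m]} -> Prop)
    (T : finType) (F : T -> {mpoly K[m]}) :
  (forall i, ideal_gen G (F i)) -> ideal_gen G (\sum_i F i).
Proof. by move=> GF; apply: big_ind; [exact: ideal_gen0 | exact: ideal_genD |]. Qed.

Lemma ideal_gen_min (m : nat) (K : finFieldType) (G J : {mpoly K[m]} -> Prop) :
  J 0 -> (forall f g, J f -> J g -> J (f + g)) ->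
  (forall a g, G g -> J (a * g)) -> forall f, ideal_gen G f -> J f.
Proof. by move=> J0 JD JM f [k [a [g [Gg ->]]]]; apply: big_ind => // i _; apply: JM. Qed.

(** * Bases of graded pieces of a quotient *)

(** An arbitrary finite index type lets a basis be indexed by pairs (power of the last variable,
    basis element) without numbering them. *)
Definition quot_family_basis (m : nat) (K : finFieldType)
    (I : {mpoly K[m]} -> Prop) (d : nat) (T : finType) (b : T -> {mpoly K[m]}) :=
  [/\ forall t, b t \is d.-homog,
      forall c : T -> K, I (\sum_t c t *: b t) -> forall t, c t = 0
    & forall f, f \is d.-homog ->
        exists c : T -> K, I (f - \sum_t c t *: b t)].

Lemma quot_family_basisE (m : nat) (K : finFieldType)
    (I : {mpoly K[m]} -> Prop) (d : nat) (T : finType) (b : T -> {mpoly K[m]}) :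
  quot_family_basis I d b -> quot_basis I d (fun i : 'I_#|T| => b (enum_val i)).
Proof.
move=> [bh bi bs]; split=> [i|c|f fh]; first exact: bh.
- have -> : \sum_i c i *: b (enum_val i) = \sum_t c (enum_rank t) *: b t.
    rewrite [RHS](reindex (fun i : 'I_#|T| => enum_val i)) //=.
      by apply: eq_bigr => i _; rewrite enum_valK.
    by exists enum_rank => ? _; rewrite ?enum_valK ?enum_rankK.
  by move=> /bi c0 i; rewrite -[i]enum_valK c0.
- have [c Ic] := bs f fh; exists (fun i => c (enum_val i)).
  suff <- : \sum_t c t *: b t = \sum_(i < #|T|) c (enum_val i) *: b (enum_val i) by [].
  rewrite (reindex (fun i : 'I_#|T| => enum_val i)) //=.
  by exists enum_rank => ? _; rewrite ?enum_valK ?enum_rankK.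
Qed.

(** Express each family in the other modulo the ideal. Independence of [b] forces the two
    coefficient matrices to multiply to the identity of size [k], which thus factors through
    dimension [l]. *)
Lemma quot_basis_le (m : nat) (K : finFieldType) (G : {mpoly K[m]} -> Prop) d
    k l (b : 'I_k -> {mpoly K[m]}) (b' : 'I_l -> {mpoly K[m]}) :
  quot_basis (ideal_gen G) d b -> quot_basis (ideal_gen G) d b' -> (k <= l)%N.
Proof.
move=> [bh bi bs] [bh' _ bs'].
have [A IA] := fin_all_exists (fun i => bs' _ (bh i)).
have [B IB] := fin_all_exists (fun i => bs _ (bh' i)).
pose MA := \matrix_(i, j) A i j; pose MB := \matrix_(i, j) B i j.
suff AB1 : MA *m MB = 1%:M by apply: mulmx1_min AB1.
apply/eqP; rewrite eq_sym -subr_eq0; apply/eqP/matrixP => i t; rewrite [RHS]mxE.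
move: t; apply: bi.
(* Row [i] of [1 - MA *m MB], read as a combination of the [b t], is a sum of elements of the
   ideal. *)
suff -> : \sum_t (1%:M - MA *m MB) i t *: b t =
    (b i - \sum_j A i j *: b' j) + \sum_j A i j *: (b' j - \sum_t B j t *: b t).
  apply: ideal_genD => //; apply: ideal_gen_sum => j; exact: ideal_genZ.
under eq_bigr => t _ do rewrite !mxE scalerBl.
rewrite sumrB (bigD1 i) //= eqxx scale1r big1 ?addr0 => [|j /negbTE]; last first.
  by rewrite eq_sym => ->; rewrite scale0r.
under [X in _ = _ + X]eq_bigr => j _ do rewrite scalerBr.
rewrite sumrB addrA subrK; congr (_ - _).
under eq_bigr => t _ do rewrite scaler_suml.
rewrite exchange_big /=; apply: eq_bigr => j _; rewrite scaler_sumr.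
by apply: eq_bigr => t _; rewrite !mxE scalerA.
Qed.

Lemma hilbert_functionE (m : nat) (K : finFieldType) (G : {mpoly K[m]} -> Prop) d
    k (b : 'I_k -> {mpoly K[m]}) :
  quot_basis (ideal_gen G) d b -> hilbert_function (ideal_gen G) d = k.
Proof.
move=> bb; rewrite /hilbert_function.
set P := fun k : nat => _.
have [b' bb'] : P (epsilon (inhabits 0%N) P) by apply: epsilon_spec; exists k, b.
by apply/eqP; rewrite eqn_leq (quot_basis_le bb' bb) (quot_basis_le bb bb').
Qed.

(** * Forms vanishing on points of the projective torus *)

Definition vanishes_on (m : nat) (K : finFieldType) (Z : {set {set 'rV[K]_m}})
    (f : {mpoly K[m]}) :=
  forall P u, P \in Z -> u \in P -> f.@[fun i => u 0 i] = 0.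

Lemma vanishing_ideal_vanishes (m : nat) (K : finFieldType)
    (Z : {set {set 'rV[K]_m}}) f :
  vanishing_ideal Z f -> vanishes_on Z f.
Proof.
apply: ideal_gen_min => [P u _ _|g h vg vh P u ZP Pu|a g [_ vg] P u ZP Pu].
- by rewrite meval0.
- by rewrite mevalD (vg P) // (vh P) // addr0.
- by rewrite mevalM (vg P) // mulr0.
Qed.

Lemma vanishing_ideal_homog (m : nat) (K : finFieldType)
    (Z : {set {set 'rV[K]_m}}) d f :
  f \is d.-homog -> vanishing_ideal Z f <-> vanishes_on Z f.
Proof.
move=> fh; split; first exact: vanishing_ideal_vanishes.
by move=> vf; apply: ideal_gen_sub; split=> //; exists d.
Qed.

Lemma meval_homog (m : nat) (K : finFieldType) d (f : {mpoly K[m]}) c (u : 'rV[K]_m) :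
  f \is d.-homog ->
  f.@[fun i => (c *: u) 0 i] = c ^+ d * f.@[fun i => u 0 i].
Proof.
move=> /dhomogP fh; rewrite !mevalE mulr_sumr !big_seq; apply: eq_bigr => a fa.
rewrite mulrCA; congr (_ * _); rewrite -(fh a fa) /= mdegE -prodrXr -big_split /=.
by apply: eq_bigr => i _; rewrite mxE exprMn.
Qed.

(** Nonzero coordinates allow division by the first coordinate and give value 1 to every power with
    exponent [#|K| - 1]. *)
Definition torus_points (m : nat) (K : finFieldType) (Z : {set {set 'rV[K]_m}}) :=
  forall P, P \in Z -> exists2 u : 'rV[K]_m, forall j, u 0 j != 0 & P = proj_point u.

Lemma mem_proj_point (m : nat) (K : finFieldType) (u w : 'rV[K]_m) :
  reflect (exists2 c, c != 0 & w = c *: u) (w \in proj_point u).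
Proof.
apply: (iffP imsetP) => [[c]|[c c0 ->]]; first by rewrite inE => c0 ->; exists c.
by exists c; rewrite ?inE.
Qed.

Lemma proj_pointZ (m : nat) (K : finFieldType) c (u : 'rV[K]_m) :
  c != 0 -> proj_point (c *: u) = proj_point u.
Proof.
move=> c0; apply/setP => w; apply/mem_proj_point/mem_proj_point => -[a a0 ->].
  by exists (a * c); rewrite ?mulf_neq0 // scalerA.
by exists (a / c); rewrite ?mulf_neq0 ?invr_eq0 // scalerA divfK.
Qed.

Lemma proj_point_id (m : nat) (K : finFieldType) (u : 'rV[K]_m) : u \in proj_point u.
Proof. by apply/mem_proj_point; exists 1; rewrite ?oner_eq0 ?scale1r. Qed.

(** With one vector fixed per point, membership of a form in the ideal becomes [#|Z|] linear
    conditions. *)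
Definition representatives (m : nat) (K : finFieldType) (Z : {set {set 'rV[K]_m}})
    (z : 'I_#|Z| -> 'rV[K]_m) :=
  [/\ forall i j, z i 0 j != 0,
      forall i, exists2 P, P \in Z & z i \in P,
      forall P u, P \in Z -> u \in P -> exists i c, u = c *: z i
    & forall i j c, c != 0 -> z i = c *: z j -> i = j].

Lemma torus_representatives (m : nat) (K : finFieldType) (Z : {set {set 'rV[K]_m}}) :
  torus_points Z -> exists z, representatives (Z := Z) z.
Proof.
move=> tZ.
have [z z0 zP] := fin_all_exists2 (fun i : 'I_#|Z| => tZ _ (enum_valP i)).
exists z; split=> // [i|P u ZP|i j c c0 eij].
- by exists (enum_val i); [exact: enum_valP | rewrite zP proj_point_id].
- rewrite -(enum_rankK_in ZP ZP) zP => /mem_proj_point [c _ ->].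
  by exists (enum_rank_in ZP P), c.
- by apply: enum_val_inj; rewrite (zP i) (zP j) eij proj_pointZ.
Qed.

Lemma vanishes_on_representatives (m : nat) (K : finFieldType)
    (Z : {set {set 'rV[K]_m}}) z d f :
  representatives (Z := Z) z -> f \is d.-homog ->
  vanishing_ideal Z f <-> forall i, f.@[fun j => z i 0 j] = 0.
Proof.
move=> [_ zZ Zz _] fh; rewrite (vanishing_ideal_homog Z fh).
split=> [vf i|vf P u ZP Pu]; first by have [P ZP Pz] := zZ i; apply: vf Pz.
have [i [c ->]] := Zz P u ZP Pu.
by rewrite (meval_homog c (z i) fh) vf mulr0.
Qed.

(** * The Hilbert function is at most the number of points and eventually equal to it *)

Lemma expf_card_pred (K : finFieldType) (x : K) : x ^+ (#|K| - 1) = (x != 0)%:R.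
Proof.
have K1 : (0 < #|K| - 1)%N by rewrite subn_gt0 finNzRing_gt1.
have [->|x0] := eqVneq x 0; first by rewrite expr0n (gtn_eqF K1).
apply: (mulfI x0); rewrite -exprS subn1 prednK ?expf_card ?mulr1 //.
exact: leq_trans (finNzRing_gt1 K).
Qed.

(** The product of the [g l] tests whether two points agree in all ratios of coordinates to the
    first one; the factor ['X_ord0 ^+ e] raises the degree at will. *)
Lemma torus_indicator (m : nat) (K : finFieldType) (Z : {set {set 'rV[K]_m.+1}}) z e i :
  representatives (Z := Z) z ->
  exists2 f, f \is ((#|K| - 1) * m.+1 + e).-homog
    & forall j, f.@[fun l => z j 0 l] = (i == j)%:R * z j 0 0 ^+ e.
Proof.
move=> [z0 _ _ zinj]; set k := (#|K| - 1)%N.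
(* At [z j] the first power is 1 and the second is 0 or 1, so [g l] takes the value 1 exactly when
   the ratios of coordinate [l] to coordinate 0 agree at [z i] and [z j]. *)
pose g l : {mpoly K[m.+1]} :=
  'X_ord0 ^+ k - (z i 0 0 *: 'X_l - z i 0 l *: 'X_ord0) ^+ k.
have hX (l : 'I_m.+1) : 'X_l \is [in K[m.+1], 1.-homog] by rewrite dhomogX /= mdeg1.
have hg l : g l \is k.-homog.
  by rewrite -[X in X.-homog](mul1n k) rpredB ?dhomogMn // rpredB ?dhomogZ ?hX.
exists (\prod_(l < m.+1) g l * 'X_ord0 ^+ e).
  apply: dhomogM; last by rewrite -[X in X.-homog](mul1n e) dhomogMn ?hX.
  have -> : (k * m.+1 = \sum_(l < m.+1) k)%N by rewrite sum_nat_const card_ord mulnC.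
  by elim/big_rec2: _ => [|l p f _ hf]; [exact: dhomog1 | exact: dhomogM].
move=> j; rewrite mevalM rmorphXn /= mevalXU; congr (_ * _).
have gj l : (g l).@[fun l => z j 0 l] = (z i 0 0 * z j 0 l == z i 0 l * z j 0 0)%:R.
  rewrite mevalB !rmorphXn /= mevalB !mevalZ !mevalXU !expf_card_pred z0 subr_eq0.
  by case: eqP => _; rewrite ?subr0 ?subrr.
rewrite rmorph_prod /=; under eq_bigr => l _ do rewrite gj.
have [<-|nij] := eqVneq i j; first by apply: big1 => l _; rewrite mulrC eqxx.
have [/forallP eqij|/forallPn [l]] :=
    boolP [forall l, z i 0 0 * z j 0 l == z i 0 l * z j 0 0].
  case/eqP: nij; apply: (zinj i j (z i 0 0 / z j 0 0)).
    by rewrite mulf_neq0 ?invr_eq0.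
  apply/rowP => l; rewrite mxE mulrAC (eqP (eqij l)) mulfK //.
by move=> /negbTE lij; rewrite (bigD1 l) //= lij mul0r.
Qed.

(** Evaluation at the representatives kills only elements of the ideal, so the evaluation matrix,
    with [#|Z|] columns, has independent rows. *)
Lemma independent_le_card (m : nat) (K : finFieldType) (Z : {set {set 'rV[K]_m}})
    d k (b : 'I_k -> {mpoly K[m]}) :
  torus_points Z -> (forall i, b i \is d.-homog) ->
  (forall c : 'I_k -> K,
      vanishing_ideal Z (\sum_(i < k) c i *: b i) -> forall i, c i = 0) ->
  (k <= #|Z|)%N.
Proof.
move=> /torus_representatives [z zr] bh bi.
pose B := \matrix_(i < k, j < #|Z|) (b i).@[fun l => z j 0 l].
suff /eqP <- : row_free B by apply: rank_leq_col.
apply/inj_row_free => c cB; apply/rowP => i; rewrite [RHS]mxE.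
move: i; apply: bi; apply/(vanishes_on_representatives (d := d) zr).
  by apply: rpred_sum => i _; apply: dhomogZ.
move=> j; move/rowP: cB => /(_ j); rewrite !mxE => <-.
by rewrite raddf_sum /=; apply: eq_bigr => i _; rewrite mevalZ mxE.
Qed.

(** Independent families have at most [#|Z|] members, and one that cannot be enlarged spans. *)
Lemma quot_basis_exists (m : nat) (K : finFieldType) (Z : {set {set 'rV[K]_m}}) d :
  torus_points Z ->
  exists k (b : 'I_k -> {mpoly K[m]}), quot_basis (vanishing_ideal Z) d b.
Proof.
move=> tZ.
pose P k := exists b : 'I_k -> {mpoly K[m]}, (forall i, b i \is d.-homog) /\
  (forall c : 'I_k -> K,
      vanishing_ideal Z (\sum_(i < k) c i *: b i) -> forall i, c i = 0).
have P0 : P 0%N by exists (fun=> 0); split=> [[]|c _ []].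
have [k [[b [bh bi]] nP]] : exists k, P k /\ ~ P k.+1.
  apply: NNPP => nex.
  have Pall k : P k.
    by elim: k => // k Pk; apply: NNPP => nPk; apply: nex; exists k.
  have [b [bh bi]] := Pall #|Z|.+1.
  by have := independent_le_card tZ bh bi; rewrite ltnn.
exists k, b; split=> // f fh.
(* If [f] were outside the span, appending it would keep independence: a relation with nonzero last
   coefficient could be solved for [f]. *)
apply: NNPP => nf; apply: nP.
exists (fun i => oapp b f (unlift ord_max i)); split=> [i|c Ic].
  by case: unliftP => [j|] _ /=.
have widenE (i : 'I_k) : widen_ord (leqnSn k) i = lift ord_max i.
  by apply: val_inj; rewrite /= /bump leqNgt ltn_ord.
rewrite big_ord_recr /= unlift_none /= in Ic.
rewrite (eq_bigr (fun i => c (lift ord_max i) *: b i)) in Ic; last first.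
  by move=> i _; rewrite widenE liftK.
have [cm|cm] := eqVneq (c ord_max) 0.
  rewrite cm scale0r addr0 in Ic.
  have c0 := bi _ Ic => i; case: (unliftP ord_max i) => [j ->|-> //].
  exact: c0.
case: nf; exists (fun i => - (c ord_max)^-1 * c (lift ord_max i)).
have := ideal_genZ (c ord_max)^-1 Ic; congr vanishing_ideal.
rewrite scalerDr scalerA mulVf // scale1r addrC scaler_sumr -sumrN; congr (_ + _).
by apply: eq_bigr => i _; rewrite mulNr scaleNr opprK scalerA.
Qed.

(** Since a basis exists, the number picked by [epsilon] is the size of one. *)
Lemma quot_basis_hilbert (m : nat) (K : finFieldType) (Z : {set {set 'rV[K]_m}}) d :
  torus_points Z ->
  exists b : 'I_(hilbert_function (vanishing_ideal Z) d) -> {mpoly K[m]},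
    quot_basis (vanishing_ideal Z) d b.
Proof.
by move=> tZ; apply: epsilon_spec (quot_basis_exists d tZ).
Qed.

Lemma hilbert_function_le_card (m : nat) (K : finFieldType)
    (Z : {set {set 'rV[K]_m}}) d :
  torus_points Z -> (hilbert_function (vanishing_ideal Z) d <= #|Z|)%N.
Proof.
move=> tZ; have [b [bh bi _]] := quot_basis_hilbert d tZ.
exact: independent_le_card bh bi.
Qed.

(** From this degree on, the indicator forms of the points are available and constitute a basis. *)
Lemma stable_from_bound (m : nat) (K : finFieldType) (Z : {set {set 'rV[K]_m.+1}}) :
  torus_points Z -> stable_from Z ((#|K| - 1) * m.+1).
Proof.
move=> tZ d /subnKC ed; set e := (d - _)%N in ed.
have [z zr] := torus_representatives tZ; have [z0 _ _ _] := zr.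
have [b bh bz] := fin_all_exists2 (fun i => torus_indicator e i zr).
rewrite ed in bh.
apply: (hilbert_functionE (b := b)).
have evb c j : (\sum_i c i *: b i).@[fun l => z j 0 l] = c j * z j 0 0 ^+ e.
  rewrite raddf_sum (bigD1 j) //= mevalZ bz eqxx mul1r big1 ?addr0 // => i /negbTE ij.
  by rewrite mevalZ bz ij mul0r mulr0.
have ch (c : 'I_#|Z| -> K) : \sum_i c i *: b i \is d.-homog.
  by apply: rpred_sum => i _; apply: dhomogZ.
split=> // [c /(vanishes_on_representatives zr (ch c)) cz i|f fh].
  by have /eqP := cz i; rewrite evb mulf_eq0 expf_eq0 (negbTE (z0 _ _)) andbF orbF => /eqP.
(* Interpolation: the indicator of point [i] takes the value [z i 0 0 ^+ e] there, so the quotient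
   restores the value of [f]. *)
exists (fun i => f.@[fun l => z i 0 l] / z i 0 0 ^+ e).
apply/(vanishes_on_representatives zr (rpredB fh (ch _))) => i.
by rewrite mevalB evb divfK ?subrr // expf_neq0.
Qed.

(** * Passing between m and m + 1 variables *)

Definition drop_last (m : nat) (K : finFieldType) (u : 'rV[K]_m.+1) : 'rV[K]_m :=
  \row_j u 0 (widen_ord (leqnSn m) j).

Definition add_last (m : nat) (K : finFieldType) (w : 'rV[K]_m) (c : K) : 'rV[K]_m.+1 :=
  \row_j oapp (w 0) c (unlift ord_max j).

Lemma widen_lift (m : nat) (i : 'I_m) : widen_ord (leqnSn m) i = lift ord_max i.
Proof. by apply: val_inj; rewrite /= /bump leqNgt ltn_ord. Qed.

Lemma add_lastK (m : nat) (K : finFieldType) c :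
  cancel (fun w : 'rV[K]_m => add_last w c) (@drop_last m K).
Proof. by move=> w; apply/rowP => j; rewrite !mxE widen_lift liftK. Qed.

Lemma add_last_max (m : nat) (K : finFieldType) (w : 'rV[K]_m) c :
  add_last w c 0 ord_max = c.
Proof. by rewrite mxE unlift_none. Qed.

Lemma mwiden_msupp (m : nat) (K : finFieldType) (f : {mpoly K[m]}) :
  mwiden f = \sum_(a <- msupp f) f@_a *: 'X_[mnmwiden a].
Proof.
rewrite {1}[f]mpolyE (raddf_sum (@mwiden m K)) /=.
by apply: eq_bigr => a _; rewrite mwidenZ mwidenX.
Qed.

Lemma meval_mwiden (m : nat) (K : finFieldType) (f : {mpoly K[m]}) (u : 'rV[K]_m.+1) :
  (mwiden f).@[fun i => u 0 i] = f.@[fun i => drop_last u 0 i].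
Proof.
rewrite mwiden_msupp [X in _ = X.@[_]]mpolyE !raddf_sum /=; apply: eq_bigr => a _.
rewrite !mevalZ !mevalX big_ord_recr /= mnmwiden_ordmax mulr1.
by congr (_ * _); apply: eq_bigr => i _;  rewrite mnmwiden_widen mxE.
Qed.

Lemma mdeg_mnmwiden (m : nat) (a : 'X_{1..m}) : mdeg (mnmwiden a) = mdeg a.
Proof.
rewrite !mdegE big_ord_recr /= mnmwiden_ordmax addn0.
by apply: eq_bigr => i _; rewrite mnmwiden_widen.
Qed.

Lemma mwiden_homog (m : nat) (K : finFieldType) (f : {mpoly K[m]}) d :
  f \is d.-homog -> mwiden f \is d.-homog.
Proof.
move=> /dhomogP fh; rewrite mwiden_msupp big_seq; apply: rpred_sum => a fa; rewrite dhomogZ //.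
by rewrite dhomogX /= mdeg_mnmwiden; apply/eqP/fh.
Qed.

(** * Division by the binomial and uniqueness of the remainder *)

Definition binomial (m : nat) (K : finFieldType) (k : nat) : {mpoly K[m.+2]} :=
  'X_ord0 ^+ k - 'X_ord_max ^+ k.

Lemma mpolyX_last (m : nat) (K : finFieldType) (a : 'X_{1..m.+1}) :
  'X_[a] = mwiden 'X_[[multinom a (widen_ord (leqnSn m) j) | j < m]]
           * 'X_ord_max ^+ a ord_max :> {mpoly K[m.+1]}.
Proof.
rewrite mwidenX mpolyXn -mpolyXD; congr 'X_[_]; apply/mnmP => i.
rewrite mnmDE mulmnE mnm1E.
case: (unliftP ord_max i) => [j ->|->]; last first.
  by rewrite mnmwiden_ordmax eqxx mul1n.
rewrite -!widen_lift mnmwiden_widen mnmE widen_lift.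
by rewrite (negbTE (neq_lift _ _)) mul0n addn0.
Qed.

(* The conditions on [g i] say that it is homogeneous of degree [d - i]
   in the integers, where [d - i < 0] forces [g i = 0]. *)
Lemma divide_by_binomial (m : nat) (K : finFieldType) k d (f : {mpoly K[m.+2]}) :
  (0 < k)%N -> f \is d.-homog ->
  exists g : 'I_k -> {mpoly K[m.+1]},
    [/\ forall i, g i \is (d - i).-homog, forall i : 'I_k, (d < i)%N -> g i = 0
      & exists h, f = \sum_(i < k) mwiden (g i) * 'X_ord_max ^+ i
                      + h * binomial m K k].
Proof.
move=> k0 /dhomogP fh; pattern f; set J := (J in J f).
(* The property is additive in [f], so a single term [f@_a *: 'X_[a]] suffices. *)
rewrite [f]mpolyE big_seq; apply: (big_ind J) => [|f1 f2 [g1 [gh1 g01 [h1 ->]]] [g2 [gh2 g02 [h2 ->]]]|a fa].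
- exists (fun=> 0); split=> // [i|]; first exact: rpred0.
  by exists 0; rewrite mul0r addr0 big1 // => i _; rewrite mwiden0 mul0r.
- exists (fun i => g1 i + g2 i); split=> [i|i di|]; first exact: rpredD.
    by rewrite g01 // g02 // addr0.
  exists (h1 + h2); rewrite mulrDl addrACA -big_split; congr (_ + _).
  by apply: eq_bigr => i _; rewrite mwidenD mulrDl.
have ad : mdeg a = d := fh a fa.
pose r := Ordinal (ltn_pmod (a ord_max) k0); pose t := (a ord_max %/ k)%N.
pose a' := [multinom a (widen_ord (leqnSn m.+1) j) | j < m.+1].
have ad' : d = (mdeg a' + t * k + r)%N.
  rewrite -addnA -divn_eq -ad !mdegE big_ord_recr /=; congr (_ + _)%N.
  by apply: eq_bigr => j _; rewrite mnmE.
(* Modulo the binomial, ['X_ord_max ^+ (t * k)] becomes ['X_ord0 ^+ (t * k)]; only the remainder [r]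
   of the last exponent survives as a power of ['X_ord_max]. *)
exists (fun i => if i == r then f@_a *: ('X_[a'] * 'X_ord0 ^+ (t * k)) else 0).
split=> [i|i di|].
- case: eqP => [->|_]; last exact: rpred0.
  rewrite ad' addnK dhomogZ // dhomogM ?dhomogX //=.
  by rewrite -[X in X.-homog](mul1n (t * k)%N) dhomogMn // dhomogX /= mdeg1.
- by case: eqP => // ir; move: di; rewrite ir ad' ltnNge leq_addl.
rewrite (bigD1 r) //= eqxx big1 ?addr0 => [|i /negbTE ->]; last first.
  by rewrite mwiden0 mul0r.
have L0 : mwiden 'X_ord0 = 'X_ord0 :> {mpoly K[m.+2]}.
  by rewrite mwidenX mnmwiden1; congr 'X_[U_(_)]; apply: val_inj.
have [h hE] : exists h : {mpoly K[m.+2]},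
    'X_ord_max ^+ (t * k) = 'X_ord0 ^+ (t * k) + h * binomial m K k.
  rewrite ![(t * k)%N]mulnC !exprM.
  (* The cofactor of x - y in x^t - y^t, negated, for x and y the k-th powers of the two
     variables. *)
  exists (- \sum_(i < t) ('X_ord0 ^+ k) ^+ (t.-1 - i) * ('X_ord_max ^+ k) ^+ i).
  by rewrite mulNr mulrC /binomial -subrXX opprB addrC subrK.
exists (f@_a *: (mwiden 'X_[a'] * 'X_ord_max ^+ r * h)).
rewrite mwidenZ mwidenM rmorphXn /= L0 mpolyX_last -/a' [in LHS](divn_eq (a ord_max) k) exprD -/t hE.
rewrite -!scalerAl -scalerDr mulrDl mulrDr; congr (_ *: (_ + _)); first by rewrite mulrA.
by rewrite [in LHS](mulrC (h * _)) !mulrA.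
Qed.

Lemma meval_binomial (m : nat) (K : finFieldType) (u : 'rV[K]_m.+2) :
  u 0 0 != 0 -> u 0 ord_max != 0 ->
  (binomial m K (#|K| - 1)).@[fun i => u 0 i] = 0.
Proof.
by move=> u0 um; rewrite mevalB !rmorphXn /= !mevalXU !expf_card_pred u0 um subrr.
Qed.

Lemma binomial_homog (m : nat) (K : finFieldType) k : binomial m K k \is k.-homog.
Proof. by rewrite -[X in X.-homog](mul1n k) rpredB ?dhomogMn ?dhomogX //= mdeg1. Qed.

(* As a polynomial in the last coordinate, the sum has degree less than
   [#|K| - 1] and vanishes at all the units. *)
Lemma coefficients_vanish (m : nat) (K : finFieldType)
    (g : 'I_(#|K| - 1) -> {mpoly K[m.+1]}) (h : {mpoly K[m.+2]}) (w : 'rV[K]_m.+1) :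
  w 0 0 != 0 ->
  (forall c, c != 0 ->
    (\sum_i mwiden (g i) * 'X_ord_max ^+ i + h * binomial m K (#|K| - 1)).@[
      fun j => add_last w c 0 j] = 0) ->
  forall i, (g i).@[fun j => w 0 j] = 0.
Proof.
move=> w0 fw; set k := (#|K| - 1)%N in g h fw *.
(* [a] extends the values of the [g i] to all natural indices, as [\poly] expects; the default 0
   concerns indices from [k] on. *)
pose a i := if insub i is Some j then (g j).@[fun l => w 0 l] else 0.
have ai (i : 'I_k) : a i = (g i).@[fun j => w 0 j] by rewrite /a valK.
pose p := \poly_(i < k) a i.
have pc c : c != 0 -> root p c.
  move=> c0; rewrite rootE horner_poly; apply/eqP; rewrite -[RHS](fw c c0).
  have u0 : add_last w c 0 0 = w 0 0.
    rewrite -[in RHS](add_lastK c w) [RHS]mxE.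
    by congr fun_of_matrix; apply: val_inj.
  rewrite mevalD mevalM meval_binomial ?add_last_max ?u0 // mulr0 addr0 raddf_sum /=.
  apply: eq_bigr => i _; rewrite mevalM rmorphXn /= mevalXU add_last_max.
  by rewrite meval_mwiden add_lastK ai.
have p0 : p = 0.
  apply/eqP; apply: contraT => np.
  (* A nonzero [p] would have size at most [#|K| - 1], yet its roots include all [#|K| - 1]
     units. *)
  have := max_poly_roots (rs := enum (predC1 (0 : K))) np.
  rewrite enum_uniq -cardE cardC1 -subn1 ltnNge size_poly; apply=> //.
  by apply/allP => c; rewrite mem_enum => /pc.
by move=> i; rewrite -ai -[RHS](coef0 _ i) -p0 coef_poly ltn_ord.
Qed.

(** * The ideal and Hilbert function of a cylinder *)

Definition proj_cone (m : nat) (K : finFieldType) (Z : {set {set 'rV[K]_m}})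
    (u : 'rV[K]_m) := exists2 P, P \in Z & u \in P.

(** The cone over [Z] is the cone over [Z'] times the units. Stating this for cones avoids
    normalizing homogeneous coordinates. *)
Definition cylinder (m : nat) (K : finFieldType) (Z' : {set {set 'rV[K]_m.+1}})
    (Z : {set {set 'rV[K]_m.+2}}) :=
  forall u, proj_cone Z u <-> u 0 ord_max != 0 /\ proj_cone Z' (drop_last u).

Lemma proj_cone_neq0 (m : nat) (K : finFieldType) (Z : {set {set 'rV[K]_m}}) u j :
  torus_points Z -> proj_cone Z u -> u 0 j != 0.
Proof.
move=> tZ [P /tZ [w w0 ->] /mem_proj_point [c c0 ->]].
by rewrite mxE mulf_neq0.
Qed.

Lemma mwiden_vanishing (m : nat) (K : finFieldType) (Z' : {set {set 'rV[K]_m.+1}})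
    (Z : {set {set 'rV[K]_m.+2}}) f :
  cylinder Z' Z -> vanishing_ideal Z' f -> vanishing_ideal Z (mwiden f).
Proof.
move=> cZ; move: f.
apply: ideal_gen_min => [|f g If Ig|a g [[d gh] gv]].
- by rewrite mwiden0; apply: ideal_gen0.
- by rewrite mwidenD; apply: ideal_genD.
rewrite mwidenM; apply: ideal_genM.
apply/(vanishing_ideal_homog Z (mwiden_homog gh)) => P u ZP Pu.
have [_ [P' ZP' Pu']] := (cZ u).1 (ex_intro2 _ _ P ZP Pu).
by rewrite meval_mwiden (gv P').
Qed.

Lemma binomial_vanishing (m : nat) (K : finFieldType) (Z : {set {set 'rV[K]_m.+2}}) :
  torus_points Z -> vanishing_ideal Z (binomial m K (#|K| - 1)).
Proof.
move=> tZ; apply/(vanishing_ideal_homog Z (binomial_homog _ _ _)) => P u ZP Pu.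
by rewrite meval_binomial // (proj_cone_neq0 _ tZ) //; exists P.
Qed.

(** Over a vector of the cone over [Z'], every nonzero last coordinate gives a vector of the cone
    over [Z], so [coefficients_vanish] applies. This serves both the ideal equality and the
    independence of the basis below. *)
Lemma coefficients_vanishing_ideal (m : nat) (K : finFieldType)
    (Z' : {set {set 'rV[K]_m.+1}}) (Z : {set {set 'rV[K]_m.+2}}) d
    (g : 'I_(#|K| - 1) -> {mpoly K[m.+1]}) (h : {mpoly K[m.+2]}) :
  torus_points Z' -> cylinder Z' Z -> (forall i, g i \is (d - i).-homog) ->
  vanishing_ideal Z
    (\sum_i mwiden (g i) * 'X_ord_max ^+ i + h * binomial m K (#|K| - 1)) ->
  forall i, vanishing_ideal Z' (g i).
Proof.
move=> tZ' cZ gh /vanishing_ideal_vanishes vf i.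
apply/(vanishing_ideal_homog Z' (gh i)) => P w ZP Pw.
have cw : proj_cone Z' w by exists P.
apply: (coefficients_vanish (h := h)) => [|c c0]; first exact: (proj_cone_neq0 _ tZ').
have [Q ZQ Qw] : proj_cone Z (add_last w c) by apply/cZ; rewrite add_last_max add_lastK.
exact: vf ZQ Qw.
Qed.

Lemma vanishing_ideal_cylinder (m : nat) (K : finFieldType)
    (Z' : {set {set 'rV[K]_m.+1}}) (Z : {set {set 'rV[K]_m.+2}}) f :
  torus_points Z' -> torus_points Z -> cylinder Z' Z ->
  vanishing_ideal Z f <->
  ideal_add (ideal_ext (vanishing_ideal Z'))
    (ideal_gen (fun g => g = binomial m K (#|K| - 1))) f.
Proof.
move=> tZ' tZ cZ; split; last first.
  move=> [a [b [Ia Ib ->]]]; apply: ideal_genD.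
    move: a Ia; apply: ideal_gen_min; [exact: ideal_gen0 | exact: ideal_genD |].
    by move=> a g [f' If' ->]; apply: ideal_genM; apply: mwiden_vanishing If'.
  move: b Ib; apply: ideal_gen_min; [exact: ideal_gen0 | exact: ideal_genD |].
  by move=> c g ->; apply: ideal_genM; apply: binomial_vanishing.
move: f; apply: ideal_gen_min.
- by exists 0, 0; rewrite addr0; split=> //; apply: ideal_gen0.
- move=> f g [a [b [Ia Ib ->]]] [a' [b' [Ia' Ib' ->]]].
  exists (a + a'), (b + b'); rewrite addrACA.
  by split=> //; apply: ideal_genD.
(* The converse inclusion is checked on homogeneous generators, which can be divided by the
   binomial. *)
move=> a f [[d fh] fv].
have If : vanishing_ideal Z f by apply/(vanishing_ideal_homog Z fh).
have k0 : (0 < #|K| - 1)%N by rewrite subn_gt0 finNzRing_gt1.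
have [g [gh _ [h fE]]] := divide_by_binomial k0 fh.
rewrite fE in If.
have Ig := coefficients_vanishing_ideal tZ' cZ gh If.
exists (a * \sum_i mwiden (g i) * 'X_ord_max ^+ i), (a * (h * binomial m K (#|K| - 1))).
split; last by rewrite -mulrDr -fE.
  apply: ideal_genM; apply: ideal_gen_sum => i; rewrite mulrC; apply: ideal_genM.
  by apply: ideal_gen_sub; exists (g i).
by do 2!apply: ideal_genM; apply: ideal_gen_sub.
Qed.

(** Multiplying a basis in degree [d - i] for [Z'] by the i-th power of the last variable, for all
    [i < #|K| - 1], gives a basis in degree [d]: division shows that it spans, uniqueness of the
    remainder that it is independent. *)
Lemma hilbert_function_cylinder (m : nat) (K : finFieldType)
    (Z' : {set {set 'rV[K]_m.+1}}) (Z : {set {set 'rV[K]_m.+2}}) d :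
  torus_points Z' -> torus_points Z -> cylinder Z' Z ->
  hilbert_function (vanishing_ideal Z) d =
  (\sum_(i < #|K| - 1)
     if (i <= d)%N then hilbert_function (vanishing_ideal Z') (d - i) else 0)%N.
Proof.
move=> tZ' tZ cZ; set k := (#|K| - 1)%N.
(* Subtraction is truncated: without the test, each [i > d] would contribute the dimension in degree
   0. *)
pose hf (i : 'I_k) :=
  if (i <= d)%N then hilbert_function (vanishing_ideal Z') (d - i) else 0%N.
have ex_b i : exists b : 'I_(hf i) -> {mpoly K[m.+1]},
    (forall j, (i <= d)%N /\ b j \is (d - i).-homog) /\
    (forall c : 'I_(hf i) -> K,
        vanishing_ideal Z' (\sum_j c j *: b j) -> forall j, c j = 0) /\
    forall f, f \is (d - i).-homog -> ((d < i)%N -> f = 0) ->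
      exists c : 'I_(hf i) -> K, vanishing_ideal Z' (f - \sum_j c j *: b j).
  rewrite /hf; case: leqP => [id|di].
    have [b [bh bi bs]] := quot_basis_hilbert (d - i) tZ'.
    by exists b; split=> //; split=> // f fh _; apply: bs.
  exists (fun=> 0); split; first by case.
  split; first by move=> c _ [].
  move=> f _ /(_ isT) ->; exists (fun=> 0); rewrite big_ord0 subr0.
  exact: ideal_gen0.
have [b bP] := fin_all_exists ex_b => {ex_b}.
pose B (t : {i : 'I_k & 'I_(hf i)}) : {mpoly K[m.+2]} :=
  mwiden (b (tag t) (tagged t)) * 'X_ord_max ^+ tag t.
have sumB (c : {i : 'I_k & 'I_(hf i)} -> K) :
    \sum_t c t *: B t =
    \sum_i mwiden (\sum_j c (Tagged (fun i => 'I_(hf i)) j) *: b i j) * 'X_ord_max ^+ i.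
  transitivity (\sum_i \sum_(j : 'I_(hf i))
      c (Tagged (fun i => 'I_(hf i)) j) *: B (Tagged (fun i => 'I_(hf i)) j)).
    by rewrite sig_big_dep /=; apply: eq_bigr => -[].
  apply: eq_bigr => i _; rewrite (raddf_sum (@mwiden m.+1 K)) /= mulr_suml.
  by apply: eq_bigr => j _; rewrite mwidenZ scalerAl.
have ch (c : {i : 'I_k & 'I_(hf i)} -> K) i :
    \sum_j c (Tagged (fun i => 'I_(hf i)) j) *: b i j \is (d - i).-homog.
  by apply: rpred_sum => j _; rewrite dhomogZ //; have [/(_ j) []] := bP i.
suff BB : quot_family_basis (vanishing_ideal Z) d B.
  rewrite (hilbert_functionE (quot_family_basisE BB)) -sum1_card.
  rewrite -(sig_big_dep xpredT (fun=> xpredT) (fun _ _ => 1%N)) /=.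
  by apply: eq_bigr => i _; rewrite sum1_card card_ord.
split=> [[i j]|c|f fh].
- have [/(_ j) [id bh] _] := bP i.
  rewrite /B /= -(subnK id) dhomogM ?mwiden_homog //.
  by rewrite -[X in X.-homog](mul1n i) dhomogMn ?dhomogX //= mdeg1.
- rewrite sumB => Ic [i j].
  have Ii : vanishing_ideal Z' (\sum_j c (Tagged (fun i => 'I_(hf i)) j) *: b i j).
    (* The combination is already a remainder, hence the zero quotient. *)
    apply: (coefficients_vanishing_ideal (h := 0) tZ' cZ (ch c)).
    by rewrite mul0r addr0.
  by have [_ [/(_ _ Ii j)]] := bP i.
have k0 : (0 < k)%N by rewrite subn_gt0 finNzRing_gt1.
have [g [gh g0 [h fE]]] := divide_by_binomial k0 fh.
have ex_c i : exists c : 'I_(hf i) -> K,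
    vanishing_ideal Z' (g i - \sum_j c j *: b i j).
  by have [_ [_]] := bP i; apply => // /g0.
have [c cP] := fin_all_exists ex_c.
exists (fun t => c (tag t) (tagged t)); rewrite sumB fE addrAC -sumrB.
apply: ideal_genD; last by apply: ideal_genM; apply: binomial_vanishing.
apply: ideal_gen_sum => i; rewrite -mulrBl -mwidenB mulrC; apply: ideal_genM.
exact: mwiden_vanishing (cP i).
Qed.

(** * Regularity and degree of a cylinder *)

(** A sum of [#|K| - 1] terms bounded by [#|Z'|] reaches its maximum only if each term does; the
    term of lowest degree, [i = #|K| - 2], decides. *)
Lemma stable_from_cylinder (m : nat) (K : finFieldType)
    (Z' : {set {set 'rV[K]_m.+1}}) (Z : {set {set 'rV[K]_m.+2}}) p :
  torus_points Z' -> torus_points Z -> cylinder Z' Z ->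
  (0 < #|Z'|)%N -> #|Z| = ((#|K| - 1) * #|Z'|)%N ->
  stable_from Z p <-> (#|K| - 2 <= p)%N /\ stable_from Z' (p - (#|K| - 2)).
Proof.
move=> tZ' tZ cZ Z'0 cardZ; rewrite /stable_from cardZ.
have K1 := finNzRing_gt1 K.
have k1 : (#|K| - 1 = (#|K| - 2).+1)%N by rewrite -subSn.
split=> [st|[qp st] d pd]; last first.
  rewrite (hilbert_function_cylinder d tZ' tZ cZ) -[(#|K| - 1)%N in RHS]card_ord -sum_nat_const.
  apply: eq_bigr => -[i /= ik] _; rewrite k1 ltnS in ik.
  by rewrite (leq_trans ik (leq_trans qp pd)) st // leq_sub.
have full d : (p <= d)%N ->
    (#|K| - 2 <= d)%N /\ hilbert_function (vanishing_ideal Z') (d - (#|K| - 2)) = #|Z'|.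
  move=> pd; have := st d pd; rewrite (hilbert_function_cylinder d tZ' tZ cZ) k1.
  rewrite big_ord_recr /= mulSn addnC => eqd.
  have : (\sum_(i < #|K| - 2) (if i <= d then
      hilbert_function (vanishing_ideal Z') (d - i) else 0) <= (#|K| - 2) * #|Z'|)%N.
    rewrite -[X in (_ <= X * _)%N]card_ord -sum_nat_const; apply: leq_sum => i _.
    by case: ifP => // _; apply: hilbert_function_le_card.
  (* If [d < #|K| - 2], the last term is 0 and the others cannot make up for it, as [Z'] is
     nonempty. *)
  move: eqd; case: leqP => [_|_]; last first.
    by rewrite add0n => ->; rewrite -[X in (_ <= X)%N]add0n leq_add2r leqNgt Z'0.
  have := hilbert_function_le_card (d - (#|K| - 2)) tZ' => h1 eqd h2.
  split=> //; apply/eqP; rewrite eqn_leq h1 /=.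
  by rewrite -(leq_add2r ((#|K| - 2) * #|Z'|)) -eqd leq_add2l.
split; first by have [] := full p (leqnn p).
move=> d pd; have [] := full (d + (#|K| - 2))%N; last by rewrite addnK.
by rewrite addnC -leq_subLR.
Qed.

Lemma card_eq_hilbert (m : nat) (K : finFieldType) (Z : {set {set 'rV[K]_m.+1}}) d0 c :
  torus_points Z ->
  (forall d, (d0 <= d)%N -> hilbert_function (vanishing_ideal Z) d = c) -> c = #|Z|.
Proof.
move=> tZ Hc; pose d := maxn d0 ((#|K| - 1) * m.+1).
rewrite -(Hc d); last exact: leq_maxl.
by apply: (stable_from_bound tZ); apply: leq_maxr.
Qed.

Lemma degE (m : nat) (K : finFieldType) (Z : {set {set 'rV[K]_m.+1}}) :
  torus_points Z -> deg Z = #|Z|.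
Proof.
move=> tZ; rewrite /deg; set P := fun D : nat => _.
have [d0 Hd0] : P (epsilon (inhabits 0%N) P).
  apply: epsilon_spec; exists #|Z|, ((#|K| - 1) * m.+1)%N => d.
  exact: stable_from_bound.
exact: card_eq_hilbert Hd0.
Qed.

(** Some stable index exists by [stable_from_bound], and descent gives a least one, so [epsilon]
    returns it. *)
Lemma regP (m : nat) (K : finFieldType) (Z : {set {set 'rV[K]_m.+1}}) :
  torus_points Z ->
  stable_from Z (reg Z) /\ forall p, stable_from Z p -> (reg Z <= p)%N.
Proof.
move=> tZ; rewrite /reg; set P := fun p : nat => _.
suff exP : exists p, P p by exact: epsilon_spec exP.
apply: NNPP => nmin.
suff nst p : ~ stable_from Z p by apply: nst (stable_from_bound tZ).
have [n] := ubnP p; elim: n p => // n IHn p; rewrite ltnS => pn st.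
apply: nmin; exists p; split=> // p' st'; rewrite leqNgt; apply/negP => p'p.
exact: IHn (leq_trans p'p pn) st'.
Qed.

(** Points are counted through Hilbert functions: in large degree every summand equals [#|Z'|]. *)
Lemma card_cylinder (m : nat) (K : finFieldType)
    (Z' : {set {set 'rV[K]_m.+1}}) (Z : {set {set 'rV[K]_m.+2}}) :
  torus_points Z' -> torus_points Z -> cylinder Z' Z ->
  #|Z| = ((#|K| - 1) * #|Z'|)%N.
Proof.
move=> tZ' tZ cZ; apply/esym.
(* Large enough that [d - i] stays in the stable range of [Z'] for every [i < #|K| - 1]. *)
pose p := (#|K| - 1 + (#|K| - 1) * m.+1)%N.
apply: (card_eq_hilbert (d0 := p) tZ) => d pd.
rewrite (hilbert_function_cylinder d tZ' tZ cZ).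
rewrite -[(#|K| - 1)%N in RHS]card_ord -sum_nat_const; apply: eq_bigr => i _.
have id : (i + (#|K| - 1) * m.+1 <= d)%N.
  by apply: leq_trans pd; rewrite leq_add2r ltnW.
rewrite (leq_trans (leq_addr _ _) id) (stable_from_bound tZ') //.
by rewrite leq_subRL // (leq_trans (leq_addr _ _) id).
Qed.

Lemma reg_cylinder (m : nat) (K : finFieldType)
    (Z' : {set {set 'rV[K]_m.+1}}) (Z : {set {set 'rV[K]_m.+2}}) :
  torus_points Z' -> torus_points Z -> cylinder Z' Z -> (0 < #|Z'|)%N ->
  reg Z = (reg Z' + (#|K| - 2))%N.
Proof.
move=> tZ' tZ cZ Z'0; have cardZ := card_cylinder tZ' tZ cZ.
have [st' min'] := regP tZ'; have [st min] := regP tZ.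
have stE p := stable_from_cylinder p tZ' tZ cZ Z'0 cardZ.
apply/eqP; rewrite eqn_leq min /=; last by apply/stE; rewrite leq_addl addnK.
by have [qp /min'] := (stE _).1 st; rewrite leq_subRL // addnC.
Qed.

(** * Toric sets and the free vertex *)

Lemma meval_mpolyX_neq0 (n : nat) (K : finFieldType) (a : 'X_{1..n}) (x : 'I_n -> K) :
  (forall i, x i != 0) -> 'X_[a].@[x] != 0.
Proof. by move=> x0; rewrite mevalX; apply/prodf_neq0 => i _; rewrite expf_neq0. Qed.

Lemma toric_set_torus_points (m n : nat) (K : finFieldType) (w : 'I_m -> 'X_{1..n}) :
  torus_points (toric_set K w).
Proof.
move=> P /imsetP [x]; rewrite inE => /forallP x0 ->.
exists (\row_j ('X_[w j] : {mpoly K[n]}).@[x]) => // j.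
by rewrite mxE meval_mpolyX_neq0.
Qed.

Lemma toric_set_neq0 (m n : nat) (K : finFieldType) (w : 'I_m -> 'X_{1..n}) :
  (0 < #|toric_set K w|)%N.
Proof.
apply/card_gt0P; pose x : {ffun 'I_n -> K} := [ffun=> 1].
exists (proj_point (\row_j ('X_[w j] : {mpoly K[n]}).@[x])).
by apply: imset_f; rewrite inE; apply/forallP => i; rewrite ffunE oner_eq0.
Qed.

Lemma proj_cone_toric (m n : nat) (K : finFieldType) (w : 'I_m -> 'X_{1..n}) u :
  proj_cone (toric_set K w) u <->
  exists (x : {ffun 'I_n -> K}) c, [/\ forall i, x i != 0, c != 0
    & u = c *: \row_j ('X_[w j] : {mpoly K[n]}).@[x]].
Proof.
split=> [[P /imsetP [x]]|[x [c [x0 c0 ->]]]].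
  by rewrite inE => /forallP x0 -> /mem_proj_point [c c0 ->]; exists x, c.
exists (proj_point (\row_j ('X_[w j] : {mpoly K[n]}).@[x])).
  by apply: imset_f; rewrite inE; apply/forallP.
by apply/mem_proj_point; exists c.
Qed.

(* The parameter [x_n] moves the last coordinate freely and does not affect
   the others. *)
Lemma toric_set_cylinder (m n : nat) (K : finFieldType) (w : 'I_m.+2 -> 'X_{1..n.+1}) :
  w ord_max ord_max = 1%N ->
  (forall i : 'I_m.+1, w (widen_ord (leqnSn m.+1) i) ord_max = 0%N) ->
  cylinder (toric_set K (fun i : 'I_m.+1 => w (widen_ord (leqnSn m.+1) i)))
    (toric_set K w).
Proof.
move=> wmax w0 u; rewrite !proj_cone_toric; split.
  move=> [x [c [x0 c0 ->]]]; split; first by rewrite !mxE mulf_neq0 ?meval_mpolyX_neq0.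
  by exists x, c; split=> //; apply/rowP => j; rewrite !mxE.
move=> [um [x [c [x0 c0 ux]]]].
(* [r] is the last monomial without its factor [x ord_max]; solving
   [c * r * y ord_max = u 0 ord_max] yields the new parameter [y]. *)
pose r := \prod_(i < n) x (widen_ord (leqnSn n) i) ^+ w ord_max (widen_ord (leqnSn n) i).
have r0 : r != 0 by apply/prodf_neq0 => i _; rewrite expf_neq0.
pose y : {ffun 'I_n.+1 -> K} :=
  [ffun i => if i == ord_max then u 0 ord_max / (c * r) else x i].
have yw i : y (widen_ord (leqnSn n) i) = x (widen_ord (leqnSn n) i).
  by rewrite ffunE widen_lift eq_sym (negbTE (neq_lift _ _)).
exists y, c; split=> // [i|].
  by rewrite ffunE; case: ifP => // _; rewrite mulf_neq0 ?invr_eq0 ?mulf_neq0.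
apply/rowP => j; rewrite !mxE mevalX big_ord_recr /=.
case: (unliftP ord_max j) => [l ->|->].
  have /rowP/(_ l) := ux; rewrite !mxE widen_lift => ->; congr (_ * _).
  rewrite mevalX big_ord_recr /= -widen_lift w0 !mulr1.
  by apply: eq_bigr => i _; rewrite yw.
rewrite wmax expr1 (eq_bigr _ (fun i _ => congr1 (fun z => z ^+ _) (yw i))) -/r.
by rewrite ffunE eqxx mulrA mulrC divfK // mulf_neq0.
Qed.

(* s = m.+2, and the clutter has n.+1 vertices; y_n and t_s are the
   last ones, ord_max. *)
Theorem theorem2p27 (K : finFieldType) (q : nat) (hq : #|K| = q) (hq2 : q <> 2%N)
    (n m : nat) (C : {set {set 'I_n.+1}}) (hC : clutter C)
    (e : 'I_m.+2 -> {set 'I_n.+1}) (he : injective e) (heC : C = [set e i | i : 'I_m.+2])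
    (v : 'I_m.+2 -> 'X_{1..n.+1}) (hv : forall i, v i = charvec (e i))
    (X : {set {set 'rV[K]_m.+2}}) (hX : X = toric_set K v)
    (X' : {set {set 'rV[K]_m.+1}})
    (hX' : X' = toric_set K (fun i : 'I_m.+1 => v (widen_ord (leqnSn m.+1) i)))
    (hfree : free_vertex C ord_max)
    (hsupp : ord_max \in supp_mon (v ord_max)) :
  [/\ forall f : {mpoly K[m.+2]},
        vanishing_ideal X f <->
        ideal_add (ideal_ext (vanishing_ideal X'))
          (ideal_gen (fun g => g = 'X_ord0 ^+ (q - 1) - 'X_ord_max ^+ (q - 1))) f,
      reg X = (reg X' + (q - 2))%N
    & deg X = ((q - 1) * deg X')%N].
Proof.
have vE i : v i ord_max = (ord_max \in e i) :> nat by rewrite hv mnmE.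
have em : ord_max \in e ord_max by move: hsupp; rewrite inE vE eqb0 negbK.
(* The free vertex lies in one edge only, which is [e ord_max]; by injectivity of [e] no other index
   gives that edge. *)
have e0 (i : 'I_m.+1) : ord_max \notin e (widen_ord (leqnSn m.+1) i).
  have /eqP/cards1P [g gP] := hfree.
  have inP j : ord_max \in e j -> e j = g.
    by move=> ej; apply/set1P; rewrite -gP inE heC imset_f.
  apply/negP => ei; have := he _ _ (etrans (inP _ ei) (esym (inP _ em))).
  by move/eqP; rewrite widen_lift eq_sym (negbTE (neq_lift _ _)).
have cX : cylinder X' X.
  rewrite hX hX'; apply: toric_set_cylinder => [|i]; first by rewrite vE em.
  by rewrite vE (negbTE (e0 i)).
have tX : torus_points X by rewrite hX; apply: toric_set_torus_points.
have tX' : torus_points X' by rewrite hX'; apply: toric_set_torus_points.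
rewrite -hq; split.
- by move=> f; apply: vanishing_ideal_cylinder.
- by apply: reg_cylinder; rewrite // hX' toric_set_neq0.
- by rewrite !degE // (card_cylinder tX' tX cX).
Qed.
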